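(* Let $N\ge2$, let $i^*=\arg\max_{k\in\mathcal N}r_kp_k$ be the (unique) maximum-throughput channel, assume $p_{i^*}<1$, and let $m_i=p_i/p_{i^*}$ for $i\in\mathcal N\setminus\{i^*\}$. Consider a file of size $F\in(k\Delta r_{i^*},(k+1)\Delta r_{i^*})$ for some integer $k\ge0$, and let $\alpha_{i^*}=F/(\Delta r_{i^*})-\lfloor F/(\Delta r_{i^*})\rfloor$. Then $$\frac{1}{1+\Delta\,\mathbf 1_{\{\alpha_{i^*}>0\}}(1-p_{i^*})r_{i^*}/F}\ \le\ \frac{\mathbb E[T(\pi^*,F)]}{\mathbb E[T(i^*,F)]}$$ and $$\frac{\mathbb E[T(\pi^*,F)]}{\mathbb E[T(i^*,F)]}\ \le\ \min_{i\in\mathcal N\setminus\{i^*\}}\left\{1,\ \frac{\dfrac{F}{\Delta r_ip_i}+\dfrac{1-p_i}{p_i}-\dfrac{k\,m_i\,(r_{i^*}p_{i^*}-r_ip_i)}{r_ip_i^2}}{(k+1)(m_i/p_i-1)}\right\},$$ where $\pi^*=\pi^*(F)$ is the dynamic optimal policy, i.e. $\mathbb E[T(\pi^*,F)]=\min_{\pi\in\Pi(F)}\mathbb E[T(\pi,F)]$, and $T(i^*,F)$ is the transfer time of the static policy that always uses channel $i^*$.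
   Context: There is a finite set of channels $\mathcal N=\{1,\dots,N\}$ and a fixed slot length $\Delta>0$. Channel $i$ has rate $r_i>0$ and availability probability $p_i\in(0,1]$. For each $i\in\mathcal N$, $\{Y_i(k)\}_{k=0,1,2,\dots}$ is an i.i.d. Bernoulli sequence with $P[Y_i(k)=1]=p_i=1-P[Y_i(k)=0]$, and these sequences are independent over channels. The channel $i^*$ is assumed unique: $r_{i^*}p_{i^*}>r_kp_k$ for all $k\in\mathcal N\setminus\{i^*\}$. A dynamic policy is a deterministic map $\pi$ from remaining file sizes $s\in[0,\infty)$ to $\mathcal N$; $\Pi(F)$ is the set of such policies for a file of size $F$. At the beginning of each slot, if the remaining file size is $s>0$, channel $\pi(s)$ is sensed. If $Y_{\pi(s)}(k)=0$ in the current slot $k$, nothing is transmitted, the slot costs time $\Delta$, and the remaining size stays $s$. If $Y_{\pi(s)}(k)=1$, data is sent at rate $r_{\pi(s)}$, the remaining size becomes $\max\{0,s-\Delta r_{\pi(s)}\}$, and the time spent is $\min\{\Delta,s/r_{\pi(s)}\}$. The process stops when the remaining size is $0$. $T(\pi,F)$ is the total (random) time spent starting from remaining size $F$ until remaining size $0$. For a channel $i$, $T(i,F)$ denotes $T(\pi,F)$ for the static (constant) policy $\pi\equiv i$. $\mathbf 1_{\{\cdot\}}$ is the indicator. The notation $\min_i\{1,a_i\}$ means the minimum of $1$ and all the numbers $a_i$. *)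

(* Defs.v *)
From HB Require Import structures.
From mathcomp Require Import all_boot all_order all_algebra.
From mathcomp Require Import all_classical all_reals all_analysis.

Set Implicit Arguments.
Unset Strict Implicit.
Unset Printing Implicit Defensive.

Import Order.TTheory GRing.Theory Num.Theory.

Local Open Scope classical_set_scope.
Local Open Scope ring_scope.

(* Mutual independence: the product rule over every finite subfamily, listed
   without repetition. *)
Definition mutually_independent (d d' : measure_display)
    (Omega : measurableType d) (T' : measurableType d') (R : realType)
    (P : probability Omega R) (I : eqType) (X : I -> {RV P >-> T'}) : Prop :=
  forall (J : seq I) (A : I -> set T'), uniq J ->
    (forall j, measurable (A j)) ->
    P (\big[setI/setT]_(j <- J) (X j @^-1` A j)) =
    (\prod_(j <- J) P (X j @^-1` A j))%E.

(* Channels are indexed by 'I_N, so 0, ..., N - 1.  A policy is a map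
   R -> 'I_N; its values at negative sizes are never used, since the remaining
   size starts positive and never becomes negative.
   Below, y i k is the availability of channel i in slot k. *)

Definition policy (R : realType) (N : nat) := R -> 'I_N.

Fixpoint remaining_size (R : realType) (N : nat) (Delta : R) (r : 'I_N -> R)
    (pi : policy R N) (F : R) (y : 'I_N -> nat -> bool) (k : nat) : R :=
  if k is k'.+1 then
    let s := remaining_size Delta r pi F y k' in
    if (0 < s) && y (pi s) k' then Num.max 0 (s - Delta * r (pi s)) else s
  else F.

(* The time spent in slot k, which is 0 once the transfer is complete. *)
Definition slot_time (R : realType) (N : nat) (Delta : R) (r : 'I_N -> R)
    (pi : policy R N) (F : R) (y : 'I_N -> nat -> bool) (k : nat) : R :=
  let s := remaining_size Delta r pi F y k in
  if 0 < s then
    if y (pi s) k then Num.min Delta (s / r (pi s)) else Delta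
  else 0.

(* Extended-real valued: it is +oo on the paths where the file is never
   completely sent. *)
Definition transfer_time (R : realType) (N : nat) (Delta : R) (r : 'I_N -> R)
    (pi : policy R N) (F : R) (y : 'I_N -> nat -> bool) : \bar R :=
  (\sum_(0 <= k <oo) (slot_time Delta r pi F y k)%:E)%E.

(* The expectation 'E_P[_] of the library only takes real-valued functions,
   hence the integral. *)
Definition expected_time (d : measure_display) (Omega : measurableType d)
    (R : realType) (P : probability Omega R) (N : nat) (Delta : R)
    (r : 'I_N -> R) (Y : 'I_N -> nat -> {RV P >-> bool})
    (pi : policy R N) (F : R) : \bar R :=
  (\int[P]_w transfer_time Delta r pi F (fun i k => Y i k w))%E.

Definition optimal_policy (d : measure_display) (Omega : measurableType d)
    (R : realType) (P : probability Omega R) (N : nat) (Delta : R)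
    (r : 'I_N -> R) (Y : 'I_N -> nat -> {RV P >-> bool})
    (F : R) (pi : policy R N) : Prop :=
  forall pi' : policy R N,
    (expected_time Delta r Y pi F <= expected_time Delta r Y pi' F)%E.

Definition static_policy (R : realType) (N : nat) (i : 'I_N) : policy R N :=
  fun=> i.
Arguments static_policy R {N} i.

(* Main.v *)
Require Import Defs.
From HB Require Import structures.
From mathcomp Require Import all_boot all_order all_algebra.
From mathcomp Require Import all_classical all_reals all_analysis.
From mathcomp Require Import measurable_realfun ring lra.

(** Conditioning on the outcome of the first slot, the expected time V(s) to send
    a remaining size s satisfies V(s) = c(s) + p V(s') + (1 - p) V(s), where s' is
    the size after a success; it is finite, so V(s) = c(s) / p + V(s'), and V is
    computed by recursion on successes alone.  The static policy thus costs
    F / r* + (k + 1) Delta (1 - p* ) / p*.  Every policy costs at least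
    F / (r* p* ), because no slot sends more than r* p* per unit of time on
    average.  For the upper bound, compare the optimum with the policy that uses
    channel i* until k of its slots succeeded and channel i afterwards. *)

Set Implicit Arguments.
Unset Strict Implicit.
Unset Printing Implicit Defensive.

Import Order.TTheory GRing.Theory Num.Theory.

Local Open Scope classical_set_scope.
Local Open Scope ring_scope.

(** * The first-slot recursion for the mean time, free of any probability space *)

Section SlotRecursion.
Variables (R : realType) (N : nat) (Delta : R) (r p : 'I_N -> R).
Variable pi : policy R N.

(** Together with [slot_cost], the one-slot dynamics in a form to which [remaining_size] and
    [slot_time] unfold by conversion. *)
Definition next_size (s : R) (x : bool) : R :=
  if (0 < s) && x then Num.max 0 (s - Delta * r (pi s)) else s.

Definition slot_cost (s : R) (x : bool) : R :=
  if 0 < s then if x then Num.min Delta (s / r (pi s)) else Delta else 0.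

(** The recursion peels off the first slot, whereas [remaining_size] peels off the last: this is
    what gives [mean_time] its first-slot equation. *)
Fixpoint mean_slot_time (j : nat) (s : R) : R :=
  if j is j'.+1 then
    p (pi s) * mean_slot_time j' (next_size s true)
    + (1 - p (pi s)) * mean_slot_time j' (next_size s false)
  else p (pi s) * slot_cost s true + (1 - p (pi s)) * slot_cost s false.

Definition mean_time (s : R) : \bar R :=
  (\sum_(0 <= j <oo) (mean_slot_time j s)%:E)%E.

Hypothesis hDelta : 0 < Delta.
Hypothesis hr : forall i, 0 < r i.
Hypothesis hp : forall i, 0 < p i <= 1.

Lemma slot_cost_ge0 s x : 0 <= slot_cost s x.
Proof.
rewrite /slot_cost; case: ifP => // s0; case: x; last exact: ltW.
by rewrite le_min ltW//= divr_ge0// ltW.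
Qed.

Lemma mean_slot_time_ge0 j s : 0 <= mean_slot_time j s.
Proof.
elim: j s => [|j IH] s /=; have /andP[/ltW p0 p1] := hp (pi s);
  by rewrite addr_ge0// mulr_ge0// ?slot_cost_ge0// subr_ge0.
Qed.

Lemma mean_slot_time_done j s : s <= 0 -> mean_slot_time j s = 0.
Proof.
move=> s0; elim: j => [|j IH] /=.
  by rewrite /slot_cost ltNge s0/=; ring.
by rewrite /next_size ltNge s0/= IH; ring.
Qed.

Lemma mean_time_ge0 s : (0 <= mean_time s)%E.
Proof. by apply: nneseries_ge0 => j _ _; rewrite lee_fin mean_slot_time_ge0. Qed.

Lemma mean_time_done s : s <= 0 -> mean_time s = 0%E.
Proof.
by move=> s0; apply: eseries0 => j _ _; rewrite mean_slot_time_done.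
Qed.

Lemma mean_time_first_slot s : 0 < s ->
  mean_time s = ((mean_slot_time 0 s)%:E
    + ((p (pi s))%:E * mean_time (next_size s true)
       + (1 - p (pi s))%:E * mean_time s))%E.
Proof.
move=> s0; have /andP[/ltW p0 p1] := hp (pi s).
rewrite {1}/mean_time nneseries_recl//; last first.
  by move=> j _; rewrite lee_fin mean_slot_time_ge0.
congr (_ + _)%E.
rewrite -nneseries_addn; last by move=> j; rewrite lee_fin mean_slot_time_ge0.
rewrite /mean_time -!nneseriesZl//; last 2 first.
- by move=> j _; rewrite lee_fin mean_slot_time_ge0.
- by move=> j _; rewrite lee_fin mean_slot_time_ge0.
rewrite -nneseriesD//.
- apply: eq_eseriesr => j _; rewrite addn1 /= EFinD !EFinM.
  by rewrite /next_size andbF.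
- by move=> j _ _; rewrite -EFinM lee_fin mulr_ge0// mean_slot_time_ge0.
- move=> j _ _; rewrite -EFinM lee_fin mulr_ge0// ?subr_ge0//.
  exact: mean_slot_time_ge0.
Qed.

(** Mean time up to and including the next success: (1 - p) / p is the mean number of failures
    before it. *)
Definition mean_success_time (s : R) : R :=
  Num.min Delta (s / r (pi s)) + Delta * (1 - p (pi s)) / p (pi s).

Lemma mean_slot_time0E s : 0 < s ->
  mean_slot_time 0 s = p (pi s) * mean_success_time s.
Proof.
move=> s0; have /andP[p0 p1] := hp (pi s).
rewrite /= /slot_cost s0 /mean_success_time.
by field; rewrite gt_eqF.
Qed.

Lemma mean_success_time_gt0 s : 0 < s -> 0 < mean_success_time s.
Proof.
move=> s0; have /andP[p0 p1] := hp (pi s).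
apply: ltr_wpDr; first by rewrite divr_ge0 ?mulr_ge0 ?subr_ge0 // ltW.
by rewrite lt_min hDelta divr_gt0.
Qed.

(** With mu = [mean_success_time s], the bound is a fixed point of the slot recursion, p mu + p x +
    (1 - p) (mu + x) = mu + x, so it passes from [n] to [n.+1]. It yields finiteness. *)
Lemma partial_mean_time_le s x n : 0 < s ->
  mean_time (next_size s true) = x%:E ->
  \sum_(0 <= j < n) mean_slot_time j s <= mean_success_time s + x.
Proof.
move=> s0 hx; have /andP[p0 p1] := hp (pi s).
have x0 : 0 <= x by rewrite -lee_fin -hx mean_time_ge0.
have hn m : \sum_(0 <= j < m) mean_slot_time j (next_size s true) <= x.
  rewrite -lee_fin -hx -sumEFin.
  by apply: nneseries_lim_ge => j _ _; rewrite lee_fin mean_slot_time_ge0.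
elim: n => [|n IH].
  by rewrite big_nil addr_ge0// ltW// mean_success_time_gt0.
rewrite big_nat_recl// mean_slot_time0E//.
rewrite [X in _ + X](_ : _ =
    p (pi s) * \sum_(0 <= j < n) mean_slot_time j (next_size s true)
    + (1 - p (pi s)) * \sum_(0 <= j < n) mean_slot_time j s); last first.
  rewrite !mulr_sumr -big_split/=; apply: eq_bigr => j _.
  by rewrite /next_size andbF.
have := ler_wpM2l (ltW p0) (hn n).
have q0 : 0 <= 1 - p (pi s) by rewrite subr_ge0.
have := ler_wpM2l q0 IH.
by lra.
Qed.

(* One slot gives [V s = c + p * V s' + (1 - p) * V s], which can be solved for
   [V s] only once [V s] is known to be finite. *)
Lemma mean_time_success s x : 0 < s ->
  mean_time (next_size s true) = x%:E ->
  mean_time s = (mean_success_time s + x)%:E.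
Proof.
move=> s0 hx; have /andP[p0 p1] := hp (pi s).
have le_s : (mean_time s <= (mean_success_time s + x)%:E)%E.
  apply: lime_le.
    by apply: is_cvg_nneseries => j _ _; rewrite lee_fin mean_slot_time_ge0.
  by apply: nearW => n; rewrite sumEFin lee_fin partial_mean_time_le.
have /fineK hfin : mean_time s \is a fin_num.
  by rewrite ge0_fin_numE ?mean_time_ge0// (le_lt_trans le_s)// ltry.
have := mean_time_first_slot s0.
rewrite hx -hfin mean_slot_time0E// -!EFinM -!EFinD => -[e].
congr EFin; apply: (mulfI (lt0r_neq0 p0)).
by move: e; lra.
Qed.

End SlotRecursion.

(** * Lower bound for every policy, and the time of policies constant on a range of sizes *)

Section MeanTimeBounds.
Variables (R : realType) (N : nat) (Delta : R) (r p : 'I_N -> R).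
Variable pi : policy R N.
Hypothesis hDelta : 0 < Delta.
Hypothesis hr : forall i, 0 < r i.
Hypothesis hp : forall i, 0 < p i <= 1.

Local Notation next := (next_size Delta r pi).
Local Notation V := (mean_time Delta r p pi).

Lemma next_size_sent s : 0 < s ->
  next s true = s - r (pi s) * Num.min Delta (s / r (pi s)).
Proof.
move=> s0; rewrite /next_size s0/=.
rewrite minr_pMr ?ltW// [_ * (s / _)]mulrC divfK ?gt_eqF//.
have [h|h] := leP (r (pi s) * Delta) s.
  by rewrite max_r 1?mulrC// subr_ge0.
by rewrite subrr max_l// subr_le0 mulrC ltW.
Qed.

(* Per unit of time at most [r i * p i] is sent on average on channel [i]: a
   failed slot costs at least as much time as the successful one. *)
Lemma mean_time_lower (theta : R) : 0 < theta ->
  (forall i, r i * p i <= theta) ->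
  forall s, exists2 x, V s = x%:E & s / theta <= x.
Proof.
move=> theta0 htheta s.
(* A success that leaves a positive size sends at least [delta], so the number of successes needed
   is bounded and can carry the induction. *)
pose delta := Delta * \big[Num.min/1]_i r i.
have delta0 : 0 < delta by rewrite mulr_gt0//; apply: lt_bigmin.
have hdelta i : delta <= Delta * r i.
  by rewrite ler_pM2l//; apply: bigmin_le.
have [n] : exists n : nat, s <= n%:R * delta.
  exists (Num.trunc (s / delta)).+1.
  by rewrite -ler_pdivrMr//; apply/ltW/truncnS_gt.
elim: n s => [|n IH] s hs.
  rewrite mul0r in hs; exists 0; first exact: mean_time_done.
  by rewrite pmulr_lle0 ?invr_gt0.
have [s0|s0] := leP s 0.
  exists 0; first exact: mean_time_done.
  by rewrite pmulr_lle0 ?invr_gt0.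
have [|x hx xge] := IH (next s true).
  rewrite /next_size s0/= ge_max mulr_ge0/= ?(ltW delta0)//.
  by have := hdelta (pi s); move: hs; rewrite -natr1 mulrDl mul1r; lra.
exists (mean_success_time Delta r p pi s + x).
  exact: mean_time_success.
have [p0 p1] := andP (hp (pi s)).
have hth := htheta (pi s).
move: xge; rewrite next_size_sent// /mean_success_time.
set mu := Num.min _ _; have muD : mu <= Delta by rewrite ge_min lexx.
have mu0 : 0 < mu by rewrite lt_min hDelta divr_gt0.
have h1 : r (pi s) * mu / theta <= mu / p (pi s).
  rewrite ler_pdivrMr// mulrAC ler_pdivlMr// -mulrA mulrC -mulrA.
  by rewrite ler_pM2l// mulrC.
have h2 : mu / p (pi s) <= mu + Delta * (1 - p (pi s)) / p (pi s).
  rewrite ler_pdivrMr// mulrDl divfK ?gt_eqF//.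
  suff : 0 <= (Delta - mu) * (1 - p (pi s)) by lra.
  by rewrite mulr_ge0// subr_ge0.
by rewrite mulrBl; lra.
Qed.

(** Exactly [n.+1] successes are needed, the last possibly partial; sending takes s / r i in total
    and each success waits for (1 - p i) / p i failures on average. Constraining [pi] only up to
    [s0] lets this apply to a policy that ends with channel [i]. *)
Lemma mean_time_static i s0 : (forall t, 0 < t -> t <= s0 -> pi t = i) ->
  forall n s, n%:R * (Delta * r i) < s -> s <= n.+1%:R * (Delta * r i) ->
  s <= s0 -> V s = (s / r i + n.+1%:R * Delta * (1 - p i) / p i)%:E.
Proof.
move=> hpi; elim=> [|n IH] s h1 h2 hs; have Dr := mulr_gt0 hDelta (hr i).
  rewrite mul0r in h1; rewrite mul1r in h2.
  rewrite (@mean_time_success _ _ _ _ _ _ _ _ _ _ 0)// ?addr0.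
    by rewrite /mean_success_time hpi// min_r ?mul1r// ler_pdivrMr.
  rewrite mean_time_done// /next_size h1/= hpi//.
  by rewrite ge_max lexx subr_le0.
have s_gt : Delta * r i < s.
  by apply: le_lt_trans h1; rewrite ler_peMl ?(ltW Dr)// ler1n.
have s_gt0 := lt_trans Dr s_gt.
rewrite -natr1 mulrDl mul1r in h1; rewrite -natr1 mulrDl mul1r in h2.
have nextE : next s true = s - Delta * r i.
  by rewrite /next_size s_gt0/= hpi// max_r// subr_ge0 ltW.
rewrite (mean_time_success hDelta hr hp s_gt0 (IH _ _ _ _)) nextE; last 3 first.
- by rewrite ltrBrDr.
- by rewrite lerBlDr.
- by move: Dr; lra.
congr EFin; rewrite /mean_success_time hpi// min_l; last first.
  by rewrite ler_pdivlMr// ltW.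
have [p0 _] := andP (hp i).
by rewrite -[n.+2%:R]natr1; field; rewrite !gt_eqF.
Qed.

(** The number of successes is less than s / (Delta * r i) + 1; this removes the rounding. *)
Lemma mean_time_static_le i s : 0 < s ->
  (forall t, 0 < t -> t <= s -> pi t = i) ->
  exists2 x, V s = x%:E & x <= s / (r i * p i) + Delta * (1 - p i) / p i.
Proof.
move=> s0 hpi; have Dr := mulr_gt0 hDelta (hr i).
have [p0 p1] := andP (hp i).
pose b := s / (Delta * r i); have sE : s = b * (Delta * r i).
  by rewrite divfK ?gt_eqF.
have b0 : 0 < b by rewrite divr_gt0.
have [n n1 n2] : exists2 n : nat, n%:R < b & b <= n.+1%:R.
  have /ex_minnP[[|n] hn nmin] : exists n : nat, b <= n%:R.
  - by exists (Num.trunc b).+1; apply/ltW/truncnS_gt.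
  - by move: hn; rewrite leNgt b0.
  - by exists n => //; rewrite ltNge; apply/negP => /nmin; rewrite ltnn.
exists (s / r i + n.+1%:R * Delta * (1 - p i) / p i).
  by apply: (mean_time_static hpi) => //; rewrite sE ?ltr_pM2r ?ler_pM2r.
rewrite {1 2}sE -natr1 -subr_ge0.
rewrite (_ : _ - _ = (b - n%:R) * Delta * (1 - p i) / p i); last first.
  by field; rewrite !gt_eqF.
by rewrite divr_ge0 ?mulr_ge0 ?subr_ge0 // ltW.
Qed.

(** Each of the [n] successes fills its slot, hence costs Delta + Delta (1 - p i) / p i = Delta / p
    i on average, and the last one lands exactly on [s0]. *)
Lemma mean_time_above i s0 x : 0 < s0 ->
  (forall t, s0 < t -> pi t = i) -> V s0 = x%:E ->
  forall n, V (s0 + n%:R * (Delta * r i)) = (n%:R * Delta / p i + x)%:E.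
Proof.
move=> s0_gt0 hpi hx; have Dr := mulr_gt0 hDelta (hr i).
have [p0 _] := andP (hp i).
elim=> [|n IH]; first by rewrite !mul0r add0r addr0.
have n0 : 0 <= n%:R * (Delta * r i) by rewrite mulr_ge0// ltW.
set s := s0 + _.
have sE : s = s0 + n%:R * (Delta * r i) + Delta * r i.
  by rewrite /s -natr1; ring.
have s_gt : s0 < s by rewrite sE -addrA ltrDl; lra.
have s_gt0 := lt_trans s0_gt0 s_gt.
have nextE : next s true = s0 + n%:R * (Delta * r i).
  rewrite /next_size s_gt0/= hpi// sE addrK max_r//.
  by rewrite addr_ge0// ltW.
have next_time : V (next s true) = (n%:R * Delta / p i + x)%:E.
  by rewrite nextE; exact: IH.
rewrite (mean_time_success hDelta hr hp s_gt0 next_time).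
congr EFin; rewrite /mean_success_time hpi// min_l; last first.
  by rewrite ler_pdivlMr// sE; lra.
by rewrite -natr1; field; rewrite gt_eqF.
Qed.

End MeanTimeBounds.

(** * The integral over the probability space equals the recursive mean time *)

Section ExpectedTime.
Variables (d : measure_display) (Omega : measurableType d) (R : realType).
Variables (P : probability Omega R) (N : nat) (Delta : R) (r p : 'I_N -> R).
Variables (Y : 'I_N -> nat -> {RV P >-> bool}) (pi : policy R N) (F : R).
Hypothesis hDelta : 0 < Delta.
Hypothesis hr : forall i, 0 < r i.
Hypothesis hp : forall i, 0 < p i <= 1.
Hypothesis hYdist : forall (i : 'I_N) (n : nat),
  distribution P (Y i n) = bernoulli_prob (p i) :> (set bool -> \bar R).
Hypothesis hYindep : mutually_independent (fun ik : 'I_N * nat => Y ik.1 ik.2).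

Local Notation next := (next_size Delta r pi).
Local Notation size_at w k :=
  (remaining_size Delta r pi F (fun i n => Y i n w) k).

Lemma measurable_avail i k (B : set bool) : measurable (Y i k @^-1` B).
Proof. by rewrite -[_ @^-1` _]setTI; apply: measurable_funP. Qed.

(** A policy need not be measurable, so preimages of all sets under [T] are required; then one
    splits over the finitely many pairs of a sensed channel and its outcome. *)
Lemma measurable_sensed (T : Omega -> R) (Q : R -> bool -> Prop) n :
  (forall B : set R, measurable (T @^-1` B)) ->
  measurable [set w | Q (T w) (Y (pi (T w)) n w)].
Proof.
move=> mT.
rewrite (_ : [set _ | _] = \bigcup_(ix in [set: 'I_N * bool])
    (T @^-1` [set s | pi s = ix.1 /\ Q s ix.2] `&` Y ix.1 n @^-1` [set ix.2])).
  apply: fin_bigcup_measurable => [|ix _]; first exact: finite_finset.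
  by apply: measurableI => //; exact: measurable_avail.
apply/seteqP; split => w /=.
  by move=> Qw; exists (pi (T w), Y (pi (T w)) n w).
by move=> [[i x] _ /= [[piT +] YE]]; rewrite piT YE.
Qed.

(** Arbitrary [B] is possible because the size depends on finitely many Boolean outcomes. *)
Lemma measurable_remaining_size k (B : set R) :
  measurable ((fun w => size_at w k) @^-1` B).
Proof.
elim: k B => [|k IH] B /=.
  have [BF|nBF] := pselect (B F).
    by rewrite (_ : _ @^-1` _ = setT)//; apply/seteqP; split.
  by rewrite (_ : _ @^-1` _ = set0)//; apply/seteqP; split.
exact: (measurable_sensed (fun s x => B (next s x)) k).
Qed.

Lemma measurable_slot_time k (D : set Omega) : measurable_fun D
  ((fun w => (slot_time Delta r pi F (fun i n => Y i n w) k)%:E)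
   : Omega -> \bar R).
Proof.
apply: measurable_funS (measurableT) (@subsetT _ _) _.
move=> _ B _; rewrite setTI.
apply: (@measurable_sensed (fun w => size_at w k)
  (fun s x => B (slot_cost Delta r pi s x)%:E)).
exact: measurable_remaining_size.
Qed.

Lemma slot_time_ge0 k w :
  0 <= slot_time Delta r pi F (fun i n => Y i n w) k.
Proof. exact: (slot_cost_ge0 pi hDelta hr (size_at w k) (Y _ k w)). Qed.

(* A history lists the outcomes of the sensed channels, the latest one first. *)
Definition size_after (b : seq bool) : R := foldr (fun x s => next s x) F b.

(** Once the outcomes are fixed, so are the sizes and the sensed channels: the event involves
    variables with deterministic indices, to which independence applies. *)
Fixpoint history_event (b : seq bool) : set Omega :=
  if b is x :: b' then
    history_event b' `&` Y (pi (size_after b')) (size b') @^-1` [set x]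
  else setT.

Fixpoint sensed (b : seq bool) : seq ('I_N * nat) :=
  if b is x :: b' then (pi (size_after b'), size b') :: sensed b' else [::].

Lemma measurable_history b : measurable (history_event b).
Proof.
elim: b => [|x b IH] //=; apply: measurableI => //; exact: measurable_avail.
Qed.

Lemma remaining_size_history b w : history_event b w ->
  size_at w (size b) = size_after b.
Proof.
elim: b => [|x b IH] //= -[/IH SE YE].
by rewrite -[LHS]/(next (size_at w (size b)) _) SE YE.
Qed.

Lemma sensed_slot_lt b j : j \in sensed b -> (j.2 < size b)%N.
Proof.
elim: b => [|x b IH] //=; rewrite inE => /predU1P[->//|/IH].
exact: leqW.
Qed.

Lemma uniq_sensed b : uniq (sensed b).
Proof.
elim: b => [|x b IH] //=; rewrite IH andbT.
by apply/negP => /sensed_slot_lt /=; rewrite ltnn.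
Qed.

(** Outcomes are indexed by slot, and [a] is free beyond [size b], so that one [a] serves both [b]
    and [x :: b] when their probabilities are compared. *)
Lemma history_eventE b (a : nat -> bool) :
  (forall n, (n < size b)%N -> a n = nth false (rev b) n) ->
  history_event b =
  \big[setI/setT]_(j <- sensed b) (Y j.1 j.2 @^-1` [set a j.2]).
Proof.
elim: b => [|x b IH] /= ha; first by rewrite big_nil.
rewrite big_cons/= setIC; congr (_ `&` _).
  by rewrite ha// rev_cons nth_rcons size_rev ltnn eqxx.
apply: IH => n nb; rewrite ha ?leqW// rev_cons nth_rcons size_rev.
by rewrite nb.
Qed.

Definition outcome_prob (i : 'I_N) (x : bool) : R := if x then p i else 1 - p i.

Lemma prob_avail i n x : P (Y i n @^-1` [set x]) = (outcome_prob i x)%:E.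
Proof.
have /andP[/ltW p0 p1] := hp i.
rewrite -[LHS]/(distribution P (Y i n) [set x]) hYdist bernoulli_probE ?p0//.
rewrite !diracE !classical_sets.in_set1 /outcome_prob.
by case: x; rewrite /= ?mule1 ?mule0 ?adde0 ?add0e.
Qed.

Lemma prob_history_cons x b :
  P (history_event (x :: b)) =
  (P (history_event b) * (outcome_prob (pi (size_after b)) x)%:E)%E.
Proof.
pose a := nth false (rev (x :: b)).
have mA (j : 'I_N * nat) : measurable [set a j.2] by [].
rewrite (@history_eventE (x :: b) a)//.
rewrite (@history_eventE b a); last first.
  by move=> n nb; rewrite /a rev_cons nth_rcons size_rev nb.
rewrite (hYindep (uniq_sensed _) mA) (hYindep (uniq_sensed b) mA) /=.
rewrite big_cons muleC; congr (_ * _)%E.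
by rewrite /a rev_cons nth_rcons size_rev ltnn eqxx/= prob_avail.
Qed.

Lemma integral_history_split (f : Omega -> \bar R) b :
  measurable_fun setT f -> (forall w, (0 <= f w)%E) ->
  (\int[P]_(w in history_event b) f w =
   \int[P]_(w in history_event (true :: b)) f w
   + \int[P]_(w in history_event (false :: b)) f w)%E.
Proof.
move=> mf f0; rewrite -ge0_integral_setU//.
- congr integral; apply/seteqP; split=> w /=.
    by move=> hb; case: (Y _ _ w); [left|right].
  by case=> -[].
- exact: measurable_history.
- exact: measurable_history.
- exact: measurable_funS mf.
- by apply/disj_set2P; apply/seteqP; split=> w //= [[_ ->] [_]].
Qed.

(** Induction on [j] with [b] general: splitting on the next outcome lengthens [b] and shortens [j],
    keeping the slot fixed. At [j = 0] the slot time is constant on each half. *)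
Lemma integral_slot_time j b :
  (\int[P]_(w in history_event b)
     (slot_time Delta r pi F (fun i n => Y i n w) (size b + j))%:E
   = P (history_event b) * (mean_slot_time Delta r p pi j (size_after b))%:E)%E.
Proof.
have f0 k w : (0 <= (slot_time Delta r pi F (fun i n => Y i n w) k)%:E)%E.
  by rewrite lee_fin slot_time_ge0.
have fin : P (history_event b) \is a fin_num.
  by apply: fin_num_measure; exact: measurable_history.
elim: j b fin => [|j IH] b fin.
  rewrite addn0 integral_history_split//; last exact: measurable_slot_time.
  have slotE x : (\int[P]_(w in history_event (x :: b))
      (slot_time Delta r pi F (fun i n => Y i n w) (size b))%:E
    = (slot_cost Delta r pi (size_after b) x)%:E
      * P (history_event (x :: b)))%E.
    rewrite -integral_cst; last exact: measurable_history.
    apply: eq_integral => w /set_mem/= -[hb YE].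
    rewrite -[slot_time _ _ _ _ _ _]/(slot_cost Delta r pi (size_at w _) _).
    by rewrite remaining_size_history// YE.
  rewrite !slotE !prob_history_cons -(fineK fin) -!EFinM -EFinD.
  by congr EFin => /=; rewrite /outcome_prob; ring.
rewrite addnS -addSn integral_history_split//; last exact: measurable_slot_time.
have fin' x : P (history_event (x :: b)) \is a fin_num.
  by apply: fin_num_measure; exact: measurable_history.
rewrite (IH (true :: b))// (IH (false :: b))// !prob_history_cons.
rewrite -(fineK fin) -!EFinM -EFinD.
by congr EFin => /=; rewrite /outcome_prob; ring.
Qed.

Lemma expected_timeE :
  expected_time Delta r Y pi F = mean_time Delta r p pi F.
Proof.
rewrite /expected_time integral_nneseries//.
- apply: eq_eseriesr => j _.
  by have := integral_slot_time j [::]; rewrite /= probability_setT mul1e.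
- by move=> j; apply: measurable_slot_time.
- by move=> j w _; rewrite lee_fin slot_time_ge0.
Qed.

End ExpectedTime.

(** * The two bounds on the ratio *)

Theorem mainTheorem6 (R : realType) (d : measure_display)
    (Omega : measurableType d) (P : probability Omega R)
    (N : nat) (hN : (2 <= N)%N)
    (Delta : R) (hDelta : 0 < Delta)
    (r p : 'I_N -> R)
    (hr : forall i, 0 < r i)
    (hp : forall i, 0 < p i <= 1)
    (Y : 'I_N -> nat -> {RV P >-> bool})
    (hYdist : forall (i : 'I_N) (n : nat),
       distribution P (Y i n) = bernoulli_prob (p i) :> (set bool -> \bar R))
    (hYindep : mutually_independent (fun ik : 'I_N * nat => Y ik.1 ik.2))
    (istar : 'I_N)
    (histar : forall i, i != istar -> r i * p i < r istar * p istar)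
    (hpstar : p istar < 1)
    (k : nat) (F : R)
    (hF : k%:R * Delta * r istar < F < (k.+1)%:R * Delta * r istar)
    (pistar : policy R N)
    (hpistar : optimal_policy Delta r Y F pistar) :
  let m := fun i => p i / p istar in
  let alpha := F / (Delta * r istar)
               - (Num.floor (F / (Delta * r istar)))%:~R in
  let ratio := (expected_time Delta r Y pistar F
                / expected_time Delta r Y (static_policy R istar) F)%E in
  ((1 / (1 + Delta * (0 < alpha)%R%:R * (1 - p istar) * r istar / F))%:E
     <= ratio)%E
  /\
  (ratio <=
     (\big[Num.min/1]_(i < N | i != istar)
        ((F / (Delta * r i * p i) + (1 - p i) / p i
          - k%:R * m i * (r istar * p istar - r i * p i) / (r i * p i ^+ 2))
         / (k.+1%:R * (m i / p i - 1))))%:E)%E.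
Proof.
move=> m alpha ratio.
have VE (pi : policy R N) := expected_timeE pi F hDelta hr hp hYdist hYindep.
have rs := hr istar; have /andP[ps _] := hp istar.
have Dr := mulr_gt0 hDelta rs.
have /andP[Fk Fk1] := hF; rewrite -mulrA in Fk; rewrite -mulrA in Fk1.
have F0 : 0 < F by apply: le_lt_trans Fk; rewrite mulr_ge0// ltW.
(* [F] lies strictly between consecutive multiples of Delta * r istar, so the indicator is 1. *)
have alpha_gt0 : 0 < alpha.
  rewrite subr_gt0 (_ : Num.floor _ = k) ?ltr_pdivlMr//.
  apply: floor_def; rewrite intrD -pmulrn natr1.
  by rewrite ler_pdivlMr// ltr_pdivrMr// ltW.
pose C := F / r istar + k.+1%:R * Delta * (1 - p istar) / p istar.
have staticE : expected_time Delta r Y (static_policy R istar) F = C%:E.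
  by rewrite VE; apply: (mean_time_static _ _ _ (s0 := F)) => //; exact: ltW.
have theta0 := mulr_gt0 rs ps.
have theta_max i : r i * p i <= r istar * p istar.
  by have [->//|/histar/ltW] := eqVneq i istar.
have [A AE Age] := mean_time_lower pistar hDelta hr hp theta0 theta_max F.
rewrite -VE in AE.
have A0 : 0 <= A by apply: le_trans Age; rewrite divr_ge0// ltW.
have q0 : 0 < 1 - p istar by rewrite subr_gt0.
have C0 : 0 < C.
  by rewrite addr_gt0 ?divr_gt0 ?mulr_gt0.
have ratioE : ratio = (A / C)%:E.
  by rewrite /ratio AE staticE inver gt_eqF// -EFinM.
rewrite ratioE !lee_fin; split.
  rewrite alpha_gt0 mulr1 div1r.
  have D0 : 0 < 1 + Delta * (1 - p istar) * r istar / F.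
    by rewrite addr_gt0// divr_gt0// !mulr_gt0.
  rewrite ler_pdivlMr// mulrC ler_pdivrMr//.
  apply: le_trans (ler_wpM2r (ltW D0) Age).
  (* The gap is the rounding loss in the static cost: [k] replaces F / (Delta * r istar). *)
  rewrite -subr_ge0 (_ : _ - _ = (1 - p istar) * (F - k%:R * (Delta * r istar))
    / (r istar * p istar)).
    by rewrite divr_ge0 ?mulr_ge0 ?subr_ge0 // ltW.
  by rewrite /C -natr1; field; rewrite !gt_eqF.
have optimal pi x : mean_time Delta r p pi F = x%:E -> A <= x.
  by move=> pix; rewrite -lee_fin -AE -pix -VE; exact: hpistar.
apply: le_bigmin.
  rewrite ler_pdivrMr// mul1r; apply: (optimal (static_policy R istar)).
  by rewrite -VE.
move=> i ine; have ri := hr i; have /andP[pi0 pi1] := hp i.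
(* The size left after [k] successes on [istar]. A policy sees only the size, so the switch of
   [mixed] is a threshold at [s0]. *)
pose s0 := F - k%:R * (Delta * r istar).
have s0_gt0 : 0 < s0 by rewrite subr_gt0.
pose mixed : policy R N := fun s => if s0 < s then istar else i.
have [|x xE xle] := mean_time_static_le (pi := mixed) (i := i)
    hDelta hr hp s0_gt0.
  by move=> t _ ts; rewrite /mixed ltNge ts.
have mixed_above t : s0 < t -> mixed t = istar by rewrite /mixed => ->.
have := mean_time_above hDelta hr hp s0_gt0 mixed_above xE k.
rewrite subrK => /optimal Ale.
set num := _ + _ - _; set den := _ * (_ - 1).
have denE : den = k.+1%:R * (1 - p istar) / p istar.
  by rewrite /den /m; field; rewrite !gt_eqF.
have den0 : 0 < den by rewrite denE divr_gt0 ?mulr_gt0.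
(* [num] and [den] count slots; times [Delta], the former is the bound on the time of [mixed]. *)
have numE : Delta * num =
    k%:R * Delta / p istar + (s0 / (r i * p i) + Delta * (1 - p i) / p i).
  by rewrite /num /m /s0; field; rewrite !gt_eqF.
have Anum : A <= Delta * num by rewrite numE; lra.
(* Only the failed slots of the static policy are kept; the sending time F / r istar is dropped. *)
have Cden : Delta * den <= C.
  by rewrite denE /C; have := divr_gt0 F0 rs; lra.
have Dden : 0 < Delta * den by rewrite mulr_gt0.
rewrite (_ : num / den = Delta * num / (Delta * den)); last first.
  by field; rewrite !gt_eqF.
by apply: ler_pM => //; [rewrite invr_ge0 ltW|rewrite lef_pV2].
Qed.
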